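(* Consider the robust Bayesian persuasion setting described in the context with monotonic Receiver utilities. For every number of states $n$ and every prior $\mu=(\mu_1,\dots,\mu_n)$ with full support, $$\mathrm{Reg}_{\mathrm{MON}}=\begin{cases}\frac{1}{e} & \text{if } \mu_n\le \frac1e,\\ -\mu_n\ln\mu_n & \text{if } \mu_n>\frac1e.\end{cases}$$
   Context: Setting: a finite state space $\Omega=[n]=\{1,\dots,n\}$ and a publicly known prior $\mu\in\Delta(\Omega)$ with $\mu_i>0$ for all $i$. A signaling scheme is a stochastic map $\pi$ from $\Omega$ to a (finite or infinite) signal set $S$; Sender commits to $\pi$, the state $\omega\sim\mu$ is drawn, a signal $s\sim\pi(\omega)$ is sent, and Receiver forms the Bayesian posterior $p(s)\in\Delta(\Omega)$. Receiver has actions $\{0,1\}$ (reject/adopt) and utility $u_r:\Omega\times\{0,1\}\to\mathbb{R}$ with $u_r(i,0)=0$ for all $i$; Receiver adopts at posterior $p$ iff $\mathbb{E}_{\omega'\sim p}[u_r(\omega',1)]\ge 0$ (ties broken in favor of adoption). Sender's utility from $\pi$ is $u(\pi,u_r)=\Pr_{s}[\text{Receiver adopts at } p(s)]$. Let $u^*(u_r)=\sup_\pi u(\pi,u_r)$. For a class $\mathcal{U}$ of Receiver utilities, $\mathrm{Reg}(\pi)=\sup_{u_r\in\mathcal{U}}\{u^*(u_r)-u(\pi,u_r)\}$ and $\mathrm{Reg}=\inf_\pi \mathrm{Reg}(\pi)$. $\mathrm{Reg}_{\mathrm{MON}}$ denotes this regret when $\mathcal{U}$ is the class of Receiver utilities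 for which $i\mapsto u_r(i,1)$ is non-decreasing in the state $i\in[n]$. *)

(* Defs.v *)
From HB Require Import structures.
From mathcomp Require Import all_boot all_order all_algebra.
From mathcomp Require Import all_classical all_reals all_analysis.
Set Implicit Arguments. Unset Strict Implicit. Unset Printing Implicit Defensive.
Import Order.TTheory GRing.Theory Num.Theory.
Local Open Scope classical_set_scope.
Local Open Scope ring_scope.

(* States are 'I_k (the paper's state i+1 is our ordinal i).
   A Receiver utility is u : 'I_k -> bool -> R, where [false] = reject (0)
   and [true] = adopt (1). *)

(* A signaling scheme with signal space S (an arbitrary measurable space):
   a reference measure nu on S and, for each state i, a density f i with
   respect to nu, so that pi(i) is the probability measure f i * nu. *)
Definition is_scheme {R : realType} {k : nat} {d : measure_display}
  {S : measurableType d} (nu : {measure set S -> \bar R}) (f : 'I_k -> S -> R) : Prop :=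
  (forall i, measurable_fun setT (f i)) /\
  (forall i s, 0 <= f i s) /\
  (forall i, (\int[nu]_s (f i s)%:E = 1)%E).

Definition posterior {R : realType} {k : nat} {S : Type}
  (mu : 'I_k -> R) (f : 'I_k -> S -> R) (s : S) : 'I_k -> R :=
  fun i => mu i * f i s / \sum_(j < k) mu j * f j s.

Definition adopts {R : realType} {k : nat} (u : 'I_k -> bool -> R) (p : 'I_k -> R) : bool :=
  0 <= \sum_(i < k) p i * u i true.

Definition sender_util {R : realType} {k : nat} {d : measure_display}
  {S : measurableType d} (mu : 'I_k -> R) (nu : {measure set S -> \bar R})
  (f : 'I_k -> S -> R) (u : 'I_k -> bool -> R) : \bar R :=
  (\sum_(i < k) (mu i)%:E *
     \int[nu]_(s in [set s | adopts u (posterior mu f s)]) (f i s)%:E)%E.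

Definition u_star {R : realType} {k : nat} (mu : 'I_k -> R) (u : 'I_k -> bool -> R)
  : \bar R :=
  ereal_sup [set x | exists (d : measure_display) (S : measurableType d)
                       (nu : {measure set S -> \bar R}) (f : 'I_k -> S -> R),
                       is_scheme nu f /\ x = sender_util mu nu f u].

Definition MON {R : realType} {k : nat} (u : 'I_k -> bool -> R) : Prop :=
  (forall i, u i false = 0) /\
  (forall i j : 'I_k, (i <= j)%N -> u i true <= u j true).

Definition regret_MON {R : realType} {k : nat} {d : measure_display}
  {S : measurableType d} (mu : 'I_k -> R) (nu : {measure set S -> \bar R})
  (f : 'I_k -> S -> R) : \bar R :=
  ereal_sup [set (u_star mu u - sender_util mu nu f u)%E | u in [set u | MON u]].

Definition Reg_MON {R : realType} {k : nat} (mu : 'I_k -> R) : \bar R :=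
  ereal_inf [set x | exists (d : measure_display) (S : measurableType d)
                       (nu : {measure set S -> \bar R}) (f : 'I_k -> S -> R),
                       is_scheme nu f /\ x = regret_MON mu nu f].

(* Main.v *)
Require Import Defs.
From HB Require Import structures.
From mathcomp Require Import all_boot all_order all_algebra.
From mathcomp Require Import all_classical all_reals all_analysis.
From mathcomp Require Import measurable_realfun.
From mathcomp Require Import ring lra.
Import Order.TTheory GRing.Theory Num.Theory.
Local Open Scope classical_set_scope.
Local Open Scope ring_scope.

(** With [m] the prior of the top state and [p = max(m, 1/e)], the value is
    [- p ln p].  A Receiver with known utility [u] is best persuaded by a
    recommendation [a : states -> [0, 1]] with [sum mu a u >= 0], and for
    monotone [u] such a recommendation may be taken to pool a top quantile.

    Upper bound: draw [y] uniformly in [[p, 1]] and pool the top quantile of mass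
    [y]; this uses up [int_p^1 dy / y = - ln p <= 1] of each state.  A Receiver
    whom full knowledge would let Sender persuade with probability [x] adopts at
    every [y <= x], and also adopts the leftover mass of the top state.

    Lower bound: consider utilities adopting iff the posterior of the top state is
    at least [tau], for [tau] uniform in [[0, m / p]].  The optimal probability
    is [min(1, m / tau)], and any scheme averages at most [p] by
    Markov/layer-cake, so its mean regret is at least [- p ln p].

    Both continuous averages are replaced by grids with [N] points, which costs
    an error [1 / N] and keeps all sums finite. *)

(** * Reduction of signaling schemes to obedient recommendations *)

Section schemes.
Context {R : realType} {k : nat} (mu : 'I_k -> R).
Hypothesis mu_pos : forall i, 0 < mu i.

(** Dividing by a positive total weight preserves the sign. If the total is [0], every
    [mu i * f i s] vanishes and division by zero returns [0], so both sides hold as ties. *)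
Lemma adopts_posteriorE {S : Type} (f : 'I_k -> S -> R) (u : 'I_k -> bool -> R)
    (s : S) : (forall i, 0 <= f i s) ->
  adopts u (posterior mu f s) = (0 <= \sum_(i < k) mu i * f i s * u i true).
Proof.
move=> f0; rewrite /adopts /posterior.
set D := \sum_(j < k) mu j * f j s.
have -> : \sum_(i < k) mu i * f i s / D * u i true =
          (\sum_(i < k) mu i * f i s * u i true) / D.
  by rewrite mulr_suml; apply: eq_bigr => i _; rewrite mulrAC.
have D0 : 0 <= D by apply: sumr_ge0 => i _; rewrite mulr_ge0// ltW.
have [Dgt|] := ltP 0 D; first by rewrite pmulr_lge0// invr_gt0.
move=> Dle; have /eqP : D = 0 by apply/le_anti; rewrite Dle D0.
rewrite psumr_eq0 => [/allP Df0|i _]; last by rewrite mulr_ge0// ltW.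
rewrite (@big1 _ _ _ _ _ _ (fun i => _ * _ * _)) ?mul0r//.
by move=> i _; rewrite (eqP (Df0 i (mem_index_enum i))) mul0r.
Qed.

Section general.
Context {d : measure_display} {S : measurableType d}
  (nu : {measure set S -> \bar R}) (f : 'I_k -> S -> R).
Hypothesis fP : is_scheme nu f.
Variable u : 'I_k -> bool -> R.

Definition adopt_set := [set s | adopts u (posterior mu f s)].

Lemma adopt_setE :
  adopt_set = [set s | 0 <= \sum_(i < k) mu i * f i s * u i true].
Proof.
case: fP => _ [f0 _]; apply/seteqP; split => s;
  by rewrite /adopt_set /= adopts_posteriorE.
Qed.

Lemma measurable_adopt_set : measurable adopt_set.
Proof.
rewrite adopt_setE; case: fP => mf _.
rewrite -[X in measurable X]setTI.
have mh : measurable_fun setT (fun s => \sum_(i < k) mu i * f i s * u i true).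
  apply: measurable_sum => i; apply: measurable_funM => //.
  exact: measurable_funM.
have -> : [set s | 0 <= \sum_(i < k) mu i * f i s * u i true] =
  (fun s => \sum_(i < k) mu i * f i s * u i true) @^-1` `[0, +oo[%classic.
  by apply/seteqP; split => s /=; rewrite in_itv/= andbT.
exact: mh.
Qed.

Definition adopt_prob (i : 'I_k) : R :=
  fine (\int[nu]_(s in adopt_set) (f i s)%:E)%E.

Lemma integral_adopt_le1 i : (0 <= \int[nu]_(s in adopt_set) (f i s)%:E <= 1)%E.
Proof.
case: fP => mf [f0 f1]; apply/andP; split.
  by apply: integral_ge0 => s _; rewrite lee_fin.
rewrite -(f1 i); apply: ge0_subset_integral => //.
- exact: measurable_adopt_set.
- exact/measurable_EFinP.
- by move=> s _; rewrite lee_fin.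
Qed.

Lemma adopt_probE i : (\int[nu]_(s in adopt_set) (f i s)%:E = (adopt_prob i)%:E)%E.
Proof.
have /andP[h0 h1] := integral_adopt_le1 i.
by rewrite fineK// ge0_fin_numE// (le_lt_trans h1)// ltry.
Qed.

Lemma adopt_prob_itv i : 0 <= adopt_prob i <= 1.
Proof. by have := integral_adopt_le1 i; rewrite adopt_probE !lee_fin. Qed.

Lemma sender_utilE :
  sender_util mu nu f u = (\sum_(i < k) mu i * adopt_prob i)%:E.
Proof.
rewrite -sumEFin; apply: eq_bigr => i _.
by rewrite -/adopt_set adopt_probE EFinM.
Qed.

(** The inequality holds pointwise on [adopt_set] and is integrated over it. For a fixed Receiver,
    an arbitrary scheme thus reduces to its vector of adoption probabilities. *)
Lemma adopt_prob_obedient : 0 <= \sum_(i < k) mu i * adopt_prob i * u i true.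
Proof.
case: fP => mf [f0 f1]; have mA := measurable_adopt_set.
have fint i : nu.-integrable adopt_set (EFin \o f i).
  apply/integrableP; split.
    by apply/measurable_EFinP; exact: measurable_funTS.
  rewrite (eq_integral (fun s => (f i s)%:E)) => [|s _].
    by rewrite adopt_probE ltry.
  by rewrite /= ger0_norm.
rewrite -lee_fin -sumEFin.
have -> : (\sum_(i < k) (mu i * adopt_prob i * u i true)%:E =
   \int[nu]_(s in adopt_set) \sum_(i < k) (mu i * u i true)%:E * (f i s)%:E)%E.
  rewrite integral_sum//.
    apply: eq_bigr => i _; rewrite integralZl//; last exact: fint.
    by rewrite adopt_probE -EFinM mulrAC.
  by move=> i; apply: integrableZl => //; exact: fint.
apply: integral_ge0 => s; rewrite adopt_setE /= => h.
rewrite (eq_bigr (fun i => (mu i * f i s * u i true)%:E)).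
  by rewrite sumEFin lee_fin.
by move=> i _; rewrite -EFinM mulrAC.
Qed.

End general.

(** * Schemes with finitely many signals *)

Section finite_schemes.
Variable N : nat.

(** Counting measure on the first [N] naturals: densities become signal probabilities, and their
    values from index [N] on are irrelevant. *)
Definition counting_below : {measure set nat -> \bar R} :=
  msum (fun i : nat => \d_i : {measure set nat -> \bar R}) N.

Lemma integral_counting_below (A : set nat) (h : nat -> R) : (forall j, 0 <= h j) ->
  (\int[counting_below]_(s in A) (h s)%:E =
   (\sum_(j < N) ((j : nat) \in A)%:R * h j)%:E)%E.
Proof.
move=> h0; rewrite ge0_integral_measure_sum//.
  rewrite -sumEFin; apply: eq_bigr => j _.
  by rewrite integral_dirac// diracE EFinM.
by move=> j _; rewrite lee_fin.
Qed.

Lemma finite_scheme (g : 'I_k -> nat -> R) : (forall i j, 0 <= g i j) ->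
  (forall i, \sum_(j < N) g i j = 1) -> is_scheme counting_below g.
Proof.
move=> g0 g1; split => //; split => // i.
rewrite integral_counting_below//; congr EFin; rewrite -[RHS](g1 i).
by apply: eq_bigr => j _; rewrite in_setT mulr1n mul1r.
Qed.

Lemma sender_util_finite (g : 'I_k -> nat -> R) (u : 'I_k -> bool -> R) :
  (forall i j, 0 <= g i j) ->
  sender_util mu counting_below g u =
  (\sum_(j < N | 0 <= \sum_(i < k) mu i * g i j * u i true)
      \sum_(i < k) mu i * g i j)%:E.
Proof.
move=> g0; rewrite /sender_util; set A := [set s | _].
under eq_bigr do rewrite integral_counting_below// -EFinM mulr_sumr.
rewrite sumEFin exchange_big [in RHS]big_mkcond; congr EFin.
apply: eq_bigr => j _ /=.
rewrite -adopts_posteriorE//.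
case: ifPn => H.
  by apply: eq_bigr => i _; rewrite mem_set// mulr1n mul1r.
rewrite big1// => i _; rewrite memNset ?mul0r ?mulr0//; exact/negP.
Qed.

End finite_schemes.

(** Two signals implement the recommendation: signal [0] says adopt and is obeyed; whatever happens
    at signal [1] can only add adoption. With [u_star_le], this makes [u_star] the value of a finite
    linear program. *)
Lemma le_u_star (u : 'I_k -> bool -> R) (a : 'I_k -> R) :
  (forall i, 0 <= a i <= 1) -> 0 <= \sum_(i < k) mu i * a i * u i true ->
  ((\sum_(i < k) mu i * a i)%:E <= u_star mu u)%E.
Proof.
move=> a01 obed.
pose g (i : 'I_k) (j : nat) := if j is 0%N then a i else 1 - a i.
have g0 i j : 0 <= g i j.
  by have /andP[a0 a1] := a01 i; case: j => [|j]//=; rewrite subr_ge0.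
have gS : is_scheme (counting_below 2) g.
  apply: finite_scheme => // i; rewrite !big_ord_recl big_ord0 /=; ring.
apply: (@le_trans _ _ (sender_util mu (counting_below 2) g u)); last first.
  by apply: ereal_sup_ubound; exists _, _, (counting_below 2), g.
rewrite sender_util_finite// lee_fin [leRHS]big_mkcond big_ord_recl /= obed lerDl.
apply: sumr_ge0 => j _; case: ifP => // _; apply: sumr_ge0 => i _.
by apply: mulr_ge0; [exact: ltW | exact: (g0 i 1%N)].
Qed.

Lemma u_star_le (u : 'I_k -> bool -> R) (M : R) :
  (forall a : 'I_k -> R, (forall i, 0 <= a i <= 1) ->
     0 <= \sum_(i < k) mu i * a i * u i true -> \sum_(i < k) mu i * a i <= M) ->
  (u_star mu u <= M%:E)%E.
Proof.
move=> H; apply: ge_ereal_sup => _ [d [S [nu [f [fP ->]]]]].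
rewrite sender_utilE// lee_fin; apply: H => [i|].
  exact: adopt_prob_itv.
exact: adopt_prob_obedient.
Qed.

End schemes.

(** * Top quantiles of the prior *)

Section greedy.
Context {R : realType} {n : nat} (mu : 'I_n.+1 -> R).
Hypothesis mu_pos : forall i, 0 < mu i.
Hypothesis mu_sum : \sum_(i < n.+1) mu i = 1.

(** Take the least state with mass at most [y] strictly above it. Minimality, applied to its
    predecessor, gives the other bound; for state [0] that bound is the total mass [1]. *)
Lemma top_mass_threshold (y : R) : 0 <= y <= 1 ->
  exists i0 : 'I_n.+1, \sum_(j < n.+1 | (i0 < j)%N) mu j <= y
    <= \sum_(j < n.+1 | (i0 <= j)%N) mu j.
Proof.
case/andP => y0 y1; pose P := [pred i : 'I_n.+1 | \sum_(j < n.+1 | (i < j)%N) mu j <= y].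
have Pmax : P ord_max.
  by rewrite /= big1// => j; rewrite ltnNge -ltnS ltn_ord.
case: (arg_minnP (fun i : 'I_n.+1 => nat_of_ord i) Pmax) => i0 Pi0 mini0.
exists i0; rewrite [X in X && _]Pi0 /=.
case: (posnP i0) => [i00|i0pos]; first by rewrite i00 mu_sum.
have ltp : (i0.-1 < n.+1)%N by rewrite (leq_ltn_trans (leq_pred _) (ltn_ord i0)).
have := contraNN (mini0 (Ordinal ltp)); rewrite /= -ltnNge ltn_predL => /(_ i0pos).
rewrite -ltNge => /ltW /le_trans; apply.
by rewrite le_eqVlt; apply/orP; left; apply/eqP/eq_bigl => j; rewrite prednK.
Qed.

(* The most favourable way of collecting mass y for an adopting Receiver: take
   it from the highest states first. *)
Lemma top_mass (y : R) : 0 <= y <= 1 ->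
  exists c : 'I_n.+1 -> R, [/\ forall i, 0 <= c i <= mu i,
    \sum_(i < n.+1) c i = y &
    forall (b v : 'I_n.+1 -> R), (forall i, 0 <= b i <= mu i) ->
      \sum_(i < n.+1) b i = y -> {homo v : i j / (i <= j)%N >-> i <= j} ->
      \sum_(i < n.+1) b i * v i <= \sum_(i < n.+1) c i * v i].
Proof.
move=> /top_mass_threshold[i0 /andP[lo hi]].
have split0 (F : 'I_n.+1 -> R) :
    \sum_(j < n.+1 | (i0 <= j)%N) F j = F i0 + \sum_(j < n.+1 | (i0 < j)%N) F j.
  rewrite (bigD1 i0)//=; congr (_ + _); apply: eq_bigl => j.
  by rewrite ltn_neqAle andbC eq_sym.
move: hi; rewrite split0 => hi.
pose c (i : 'I_n.+1) := if (i0 < i)%N then mu i else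
  if i == i0 then y - \sum_(j < n.+1 | (i0 < j)%N) mu j else 0.
have c01 i : 0 <= c i <= mu i.
  rewrite /c; case: ifP => _; first by rewrite lexx ltW.
  case: eqP => [->|_]; last by rewrite lexx ltW.
  by apply/andP; split; lra.
have cs : \sum_(i < n.+1) c i = y.
  rewrite (bigID (fun j : 'I_n.+1 => (i0 <= j)%N)) /= split0 [X in _ + X]big1; last first.
    move=> i; rewrite -ltnNge => ii0; rewrite /c ltnNge ltnW//=.
    by rewrite -val_eqE /= ltn_eqF.
  have -> : \sum_(j < n.+1 | (i0 < j)%N) c j = \sum_(j < n.+1 | (i0 < j)%N) mu j.
    by apply: eq_bigr => j; rewrite /c => ->.
  by rewrite /c ltnn eqxx; lra.
exists c; split=> // b v b01 bs vhomo.
rewrite -subr_ge0 -sumrB.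
(* Since [b] and [c] have equal mass, [v] may be recentred at [v i0]; then both factors of each term
   have the same sign. *)
have -> : \sum_(i < n.+1) (c i * v i - b i * v i) =
          \sum_(i < n.+1) (c i - b i) * (v i - v i0).
  under [RHS]eq_bigr do rewrite mulrBr mulrBl.
  by rewrite [RHS]sumrB -mulr_suml (sumrB _ _ c b) cs bs subrr mul0r subr0.
apply: sumr_ge0 => i _; have /andP[b0 b1] := b01 i; rewrite /c.
case: ltngtP => [i0i|ii0|/val_inj <-]; last by rewrite subrr mulr0.
- by apply: mulr_ge0; rewrite subr_ge0//; apply: vhomo; exact: ltnW.
- rewrite -val_eqE /= ltn_eqF// mulr_le0// subr_le0//.
  by apply: vhomo; exact: ltnW.
Qed.

(* Scaling an obedient recommendation down to total mass y keeps it feasible,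
   so the top mass y is obedient too. *)
Lemma top_mass_obedient (y : R) (u : 'I_n.+1 -> bool -> R) (a c : 'I_n.+1 -> R) :
  MON u -> (forall i, 0 <= a i <= 1) ->
  0 <= \sum_(i < n.+1) mu i * a i * u i true ->
  0 < y <= \sum_(i < n.+1) mu i * a i ->
  (forall (b v : 'I_n.+1 -> R), (forall i, 0 <= b i <= mu i) ->
      \sum_(i < n.+1) b i = y -> {homo v : i j / (i <= j)%N >-> i <= j} ->
      \sum_(i < n.+1) b i * v i <= \sum_(i < n.+1) c i * v i) ->
  0 <= \sum_(i < n.+1) c i * u i true.
Proof.
move=> [_ umon] a01 obed /andP[y0 yx] cmax.
set x := \sum_(i < n.+1) mu i * a i in yx.
have x0 : 0 < x by exact: lt_le_trans yx.
have r0 : 0 <= y / x by rewrite divr_ge0// ltW.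
have r1 : y / x <= 1 by rewrite ler_pdivrMr// mul1r.
apply: le_trans (cmax (fun i => y / x * (mu i * a i)) (fun i => u i true) _ _ _).
- rewrite (eq_bigr (fun i => y / x * (mu i * a i * u i true))).
    by rewrite -mulr_sumr mulr_ge0.
  by move=> i _; rewrite !mulrA.
- move=> i; have /andP[a0 a1] := a01 i; have m0 := ltW (mu_pos i).
  have ma0 : 0 <= mu i * a i by rewrite mulr_ge0.
  rewrite mulr_ge0//= -[leRHS]mul1r ler_pM//.
  by rewrite ler_piMr.
- by rewrite -mulr_sumr -/x divfK// gt_eqF.
- by move=> i j; exact: umon.
Qed.

End greedy.

(** * Grid versions of the integrals *)

Section calculus.
Context {R : realType}.

Lemma ln_le_subr1 (x : R) : 0 < x -> ln x <= x - 1.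
Proof.
by move=> x0; rewrite -[in ln x](subrKC 1 x); apply: le_ln1Dx; lra.
Qed.

Lemma ln_ratio_le (a b : R) : 0 < a -> 0 < b -> ln b - ln a <= b / a - 1.
Proof.
by move=> a0 b0; rewrite -ln_div ?posrE//; apply: ln_le_subr1; rewrite divr_gt0.
Qed.

(** A right-endpoint Riemann sum of the decreasing function [1 / s] lies below its integral. *)
Lemma sum_inv_le_ln (p w : R) (N : nat) : 0 < p -> 0 <= w ->
  \sum_(j < N) w / (p + j.+1%:R * w) <= ln (p + N%:R * w) - ln p.
Proof.
move=> p0 w0; elim: N => [|N IH]; first by rewrite big_ord0 mul0r addr0 subrr.
rewrite big_ord_recr /=.
set y := p + N%:R * w in IH *; set z := p + N.+1%:R * w.
have zy : z = y + w by rewrite /z /y -natr1; ring.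
have y0 : 0 < y by rewrite /y ltr_wpDr// mulr_ge0.
have z0 : 0 < z by rewrite zy ltr_wpDr.
suff : w / z <= ln z - ln y by lra.
have := ln_ratio_le z y z0 y0.
have -> : y / z = 1 - w / z by rewrite zy in z0 *; field; lra.
lra.
Qed.

(** If the last index is counted, its own condition bounds the sum of all terms up to it; otherwise
    the sum does not change. *)
Lemma count_le_threshold (N : nat) (D z : R) : 0 <= z -> 0 <= D ->
  \sum_(j < N | j.+1%:R * D <= z) D <= z.
Proof.
move=> z0 D0; elim: N => [|N IH]; first by rewrite big_ord0.
rewrite big_mkcond big_ord_recr /= -big_mkcond /=.
case: ifPn => [h|_]; last by rewrite addr0.
apply: le_trans h; rewrite -natr1 mulrDl mul1r lerD2r.
rewrite big_mkcond -[N in leRHS]card_ord -sum1_card natr_sum mulr_suml.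
by apply: ler_sum => j _; rewrite mul1r; case: ifP.
Qed.

(** Rounding [x] down to the grid loses at most one cell of width [w]; the minimum accounts for the
    end of the grid. *)
Lemma grid_count_ge (p w x : R) (N : nat) : 0 <= w ->
  Num.min (x - w) (p + N%:R * w) - p <= \sum_(j < N | p + j.+1%:R * w <= x) w.
Proof.
move=> w0; elim: N => [|N IH].
  by rewrite big_ord0 mul0r addr0 subr_le0 ge_min lexx orbT.
rewrite big_mkcond big_ord_recr /= -big_mkcond /=.
set S := \sum_(j < N | _) w in IH *; move: IH.
have -> : p + N.+1%:R * w = p + N%:R * w + w by rewrite -natr1; ring.
set q := p + N%:R * w; case: ifPn; rewrite -?ltNge => h; rewrite !minEle.
  by case: ifP; case: ifP; rewrite -?ltNge; lra.
case: ifP; case: ifP => ? ?; lra.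
Qed.

(* [concave_env p t] is the integral of [min(1, p/s)] over [0, t]. *)
Definition concave_env (p t : R) : R := if t <= p then t else p + p * (ln t - ln p).

(** By concavity the graph lies below its tangent at [a]; the two branches meet at [p] with common
    slope [1]. *)
Lemma concave_env_tangent (p a b : R) : 0 < p -> 0 < a -> a <= b ->
  concave_env p b - concave_env p a <= (b - a) * Num.min 1 (p / a).
Proof.
move=> p0 a0 ab; rewrite /concave_env.
have b0 : 0 < b by exact: lt_le_trans ab.
case: (leP a p) => ap.
  have -> : Num.min 1 (p / a) = 1 by apply/min_idPl; rewrite ler_pdivlMr// mul1r.
  case: (leP b p) => bp; first by lra.
  have : p * (ln b - ln p) <= p * (b / p - 1) by rewrite ler_pM2l// ln_ratio_le.
  have -> : p * (b / p - 1) = b - p by field; rewrite gt_eqF.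
  by lra.
rewrite (leNgt b) (lt_le_trans ap ab) /=.
have -> : Num.min 1 (p / a) = p / a.
  by apply/min_idPr; rewrite ler_pdivrMr// mul1r ltW.
have : p * (ln b - ln a) <= p * (b / a - 1) by rewrite ler_pM2l// ln_ratio_le.
have -> : p * (b / a - 1) = (b - a) * (p / a) by field; rewrite gt_eqF.
lra.
Qed.

Lemma grid_sum_min_ge (p : R) (N : nat) : 0 < p <= 1 -> (0 < N)%N ->
  p - p * ln p - N%:R^-1 <=
  \sum_(j < N) N%:R^-1 * Num.min 1 (p * N%:R / j.+1%:R).
Proof.
move=> /andP[p0 p1] N0; have NR0 : 0 < N%:R :> R by rewrite ltr0n.
(* The tangent bounds telescope from [1 / N] to [M.+1 / N]. The missing first cell is worth at most
   [1 / N], which is the error term. *)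
have tele M : concave_env p (M.+1%:R / N%:R) - N%:R^-1 <=
    \sum_(j < M) N%:R^-1 * Num.min 1 (p * N%:R / j.+1%:R).
  elim: M => [|M IH].
    rewrite big_ord0 subr_le0 /concave_env div1r; case: (leP _ p) => // lt.
    have i0 : 0 < N%:R^-1 :> R by rewrite invr_gt0.
    have : p * (ln N%:R^-1 - ln p) <= p * (N%:R^-1 / p - 1).
      by rewrite ler_pM2l// ln_ratio_le.
    have -> : p * (N%:R^-1 / p - 1) = N%:R^-1 - p by field; rewrite !gt_eqF.
    by lra.
  rewrite big_ord_recr /=.
  have M0 : 0 < M.+1%:R / N%:R :> R by rewrite divr_gt0.
  have MM : M.+1%:R / N%:R <= M.+2%:R / N%:R :> R by rewrite ler_pM2r ?invr_gt0// ler_nat.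
  have := concave_env_tangent p _ _ p0 M0 MM.
  have -> : M.+2%:R / N%:R - M.+1%:R / N%:R = N%:R^-1 :> R.
    by rewrite -mulrBl -[M.+2]addn1 natrD addrC addKr mul1r.
  by rewrite invf_div mulrA; move: IH; lra.
apply: le_trans (tele N); rewrite lerD2r /concave_env.
have NN : 1 < N.+1%:R / N%:R :> R by rewrite ltr_pdivlMr// mul1r ltr_nat.
rewrite (leNgt _ p) (le_lt_trans p1 NN) /=.
have : 0 <= p * ln (N.+1%:R / N%:R) by rewrite mulr_ge0 ?ln_ge0// ltW.
lra.
Qed.

End calculus.

(** * Lower bound: threshold Receivers *)

Section lower_bound.
Context {R : realType} {n : nat} (mu : 'I_n.+1 -> R).
Hypothesis mu_pos : forall i, 0 < mu i.
Hypothesis mu_sum : \sum_(i < n.+1) mu i = 1.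
Let m := mu ord_max.

Definition threshold_util (tau : R) (i : 'I_n.+1) (b : bool) : R :=
  if b then (i == ord_max)%:R - tau else 0.

Lemma threshold_util_MON tau : MON (threshold_util tau).
Proof.
split=> // i j ij; rewrite lerD2r ler_nat.
case: (i =P ord_max) => [imax|]//=.
have -> : j = ord_max; last by rewrite eqxx.
by apply/val_inj/anti_leq; rewrite -ltnS ltn_ord /= -[X in (X <= _)%N]/(val (@ord_max n)) -imax.
Qed.

Lemma sum_threshold_util (h : 'I_n.+1 -> R) tau :
  \sum_(i < n.+1) h i * threshold_util tau i true =
  h ord_max - tau * \sum_(i < n.+1) h i.
Proof.
rewrite /threshold_util; under eq_bigr do rewrite mulrBr.
rewrite sumrB -mulr_suml mulrC; congr (_ - _).
rewrite (bigD1 ord_max)//= eqxx mulr1 big1 ?addr0// => i /negbTE ->.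
by rewrite mulr0.
Qed.

Lemma top_prior_le1 : m <= 1.
Proof.
by rewrite -mu_sum (bigD1 ord_max)//= lerDl sumr_ge0// => i _; rewrite ltW.
Qed.

Lemma u_star_threshold tau : 0 < tau <= 1 ->
  ((Num.min 1 (m / tau))%:E <= u_star mu (threshold_util tau))%E.
Proof.
case/andP => t0 t1; set x := Num.min _ _.
have m0 : 0 < m by exact: mu_pos.
have m1 := top_prior_le1.
have x1 : x <= 1 by rewrite /x ge_min lexx.
have xm : x * tau <= m by rewrite -ler_pdivlMr// /x ge_min lexx orbT.
have mx : m <= x.
  by rewrite /x le_min m1 ler_pdivlMr// ler_piMr// ltW.
(* The recommendation always adopts at the top state and adopts elsewhere with the probability [al]
   that brings the total mass to [x]. If [m = 1], then [al = 0] and [x = m]. *)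
pose al := (x - m) / (1 - m).
have al01 : 0 <= al <= 1.
  have [me1|mlt] := eqVneq m 1; first by rewrite /al me1 subrr invr0 mulr0 lexx ler01.
  have : 0 < 1 - m by rewrite subr_gt0 lt_neqAle mlt.
  move=> p; rewrite /al divr_ge0 ?subr_ge0//= ler_pdivrMr// mul1r lerD2r//.
have alE : al * (1 - m) = x - m.
  have [me1|mlt] := eqVneq m 1; last first.
    by rewrite divfK// subr_eq0 eq_sym.
  by move: mx; rewrite me1 subrr mulr0 => mx; apply/eqP; rewrite eq_sym subr_eq0 eq_le mx x1.
pose a (i : 'I_n.+1) : R := if i == ord_max then 1 else al.
have sa : \sum_(i < n.+1) mu i * a i = x.
  have ms : m + \sum_(i < n.+1 | i != ord_max) mu i = 1.
    by rewrite -mu_sum [RHS](bigD1 ord_max).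
  rewrite (bigD1 ord_max)//= /a eqxx mulr1 (eq_bigr (fun i => mu i * al)); last first.
    by move=> i /negbTE ->.
  rewrite -mulr_suml.
  have -> : \sum_(i < n.+1 | i != ord_max) mu i = 1 - m by rewrite -ms addrAC subrr add0r.
  by rewrite -/m mulrC alE subrKC.
rewrite -sa; apply: le_u_star => //.
  by move=> i; rewrite /a; case: ifP => _//; rewrite ler01 lexx.
by rewrite sum_threshold_util sa /a eqxx mulr1 -/m mulrC subr_ge0.
Qed.

Section scheme.
Context {d : measure_display} {S : measurableType d}
  (nu : {measure set S -> \bar R}) (f : 'I_n.+1 -> S -> R).
Hypothesis fP : is_scheme nu f.

Let util tau := \sum_(i < n.+1) mu i * adopt_prob mu nu f (threshold_util tau) i.

(* A signal with posterior weight [q] on the top state is adopted at [tau] iff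
   [tau <= q], so averaging over the grid recovers at most the mean of [q]. *)
Lemma sum_util_threshold (T : R) (N : nat) : 0 < T -> (0 < N)%N ->
  \sum_(j < N) util (j.+1%:R * T / N%:R) <= m * N%:R / T.
Proof.
have m0 : 0 <= m by exact/ltW/mu_pos.
move=> T0 N0; have NR0 : 0 < N%:R :> R by rewrite ltr0n.
have [mf [f0 f1]] := fP.
pose tau (j : nat) := j.+1%:R * T / N%:R.
pose D s := \sum_(i < n.+1) mu i * f i s.
have D0 s : 0 <= D s by apply: sumr_ge0 => i _; rewrite mulr_ge0// ltW.
have mD : measurable_fun setT D.
  by apply: measurable_sum => i; exact: measurable_funM.
pose A j := adopt_set mu f (threshold_util (tau j)).
have mA j : measurable (A j) by exact: (measurable_adopt_set mu mu_pos nu f fP).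
(* Clearing denominators gives the form counted by [count_le_threshold], and also covers signals
   with [D s = 0]. *)
have AE j s : (s \in A j) = (j.+1%:R * D s <= N%:R / T * (m * f ord_max s)).
  rewrite -[RHS](ler_pM2l (divr_gt0 T0 NR0)).
  have -> : T / N%:R * (N%:R / T * (m * f ord_max s)) = m * f ord_max s.
    by field; rewrite !gt_eqF.
  have -> : T / N%:R * (j.+1%:R * D s) = tau j * D s by rewrite /tau; ring.
  rewrite /A (adopt_setE mu mu_pos nu f fP).
  by apply/idP/idP; rewrite inE /= sum_threshold_util subr_ge0.
have utilE j : (util (tau j))%:E = (\int[nu]_s ((D s)%:E * (\1_(A j) s)%:E))%E.
  rewrite -sender_utilE// /sender_util.
  have -> : (\int[nu]_s ((D s)%:E * (\1_(A j) s)%:E) = \int[nu]_(s in A j) (D s)%:E)%E.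
    rewrite [RHS]integral_mkcond; apply: eq_integral => s _.
    rewrite patchE indicE; case: ifP => _; by rewrite ?mule1 ?mule0.
  rewrite /D; under [RHS]eq_integral do rewrite -sumEFin.
  rewrite ge0_integral_sum//; last 2 first.
  - by move=> i; apply/measurable_EFinP/measurable_funTS/measurable_funM.
  - by move=> i s _; rewrite lee_fin mulr_ge0// ltW.
  apply: eq_bigr => i _; under [RHS]eq_integral do rewrite EFinM.
  rewrite ge0_integralZl_EFin//.
  - by move=> s _; rewrite lee_fin.
  - by apply/measurable_EFinP/measurable_funTS.
  - exact: ltW.
have mDA j : measurable_fun setT (fun s => (D s)%:E * (\1_(A j) s)%:E)%E.
  apply: emeasurable_funM; first exact/measurable_EFinP.
  by apply/measurable_EFinP/measurable_indic.
rewrite -lee_fin -sumEFin (eq_bigr _ (fun (j : 'I_N) _ => utilE j)).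
rewrite -ge0_integral_sum//; last first.
  by move=> j s _; rewrite -EFinM lee_fin mulr_ge0.
have -> : (m * N%:R / T)%:E = (\int[nu]_s (N%:R / T * (m * f ord_max s))%:E)%E.
  under eq_integral do rewrite EFinM (EFinM m).
  have c0 : 0 <= N%:R / T by rewrite divr_ge0// ltW.
  rewrite ge0_integralZl_EFin//; last 2 first.
  - by move=> s _; rewrite -EFinM lee_fin mulr_ge0.
  - by under eq_fun do rewrite -EFinM; apply/measurable_EFinP/measurable_funM.
  rewrite ge0_integralZl_EFin//; last 2 first.
  - by move=> s _; rewrite lee_fin.
  - exact/measurable_EFinP.
  by rewrite f1 mule1 -EFinM; congr EFin; ring.
have z0 s : 0 <= N%:R / T * (m * f ord_max s).
  by apply: mulr_ge0; [rewrite divr_ge0// ltW|rewrite mulr_ge0].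
apply: ge0_le_integral => //.
- by move=> s _; apply: sume_ge0 => j _; rewrite -EFinM lee_fin mulr_ge0.
- exact: emeasurable_sum.
- by apply/measurable_EFinP/measurable_funM => //; exact: measurable_funM.
move=> s _; under eq_bigr do rewrite -EFinM.
rewrite sumEFin lee_fin.
apply: le_trans (count_le_threshold N (D s) _ (z0 s) (D0 s)).
rewrite [leRHS]big_mkcond; apply: ler_sum => j _.
by rewrite indicE AE; case: ifP; rewrite ?mulr1 ?mulr0.
Qed.

Lemma regret_MON_ge (p : R) : m <= p <= 1 ->
  ((- (p * ln p))%:E <= regret_MON mu nu f)%E.
Proof.
move=> /andP[mp p1]; have m0 : 0 < m by exact: mu_pos.
have p0 : 0 < p by exact: lt_le_trans mp.
apply/lee_addgt0Pr => e e0.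
pose N := (Num.truncn e^-1).+1.
have N0 : (0 < N)%N by [].
have NR0 : 0 < N%:R :> R by rewrite ltr0n.
have Ne : N%:R^-1 <= e.
  by rewrite invf_ple ?posrE// ltW// truncnS_gt.
(* This scale turns [m / tau j] into [p * N / j.+1], the summand of [grid_sum_min_ge], and bounds
   the mean utility by [p]. *)
pose T := m / p; have T0 : 0 < T by rewrite divr_gt0.
have T1 : T <= 1 by rewrite ler_pdivrMr// mul1r.
pose tau (j : nat) := j.+1%:R * T / N%:R.
suff [j hj] : exists j : 'I_N,
    - (p * ln p) - N%:R^-1 <= Num.min 1 (m / tau j) - util (tau j).
  apply: (@le_trans _ _ ((- (p * ln p) - N%:R^-1)%:E + e%:E)%E).
    by rewrite -EFinD lee_fin; lra.
  rewrite leeD2r//.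
  have t01 : 0 < tau j <= 1.
    apply/andP; split; first by apply: divr_gt0 => //; exact: mulr_gt0.
    rewrite /tau ler_pdivrMr// mul1r.
    apply: (@le_trans _ _ j.+1%:R); first by rewrite ler_piMr.
    by rewrite ler_nat.
  apply: (@le_trans _ _ (u_star mu (threshold_util (tau j)) -
            sender_util mu nu f (threshold_util (tau j)))%E); last first.
    apply: ereal_sup_ubound; exists (threshold_util (tau j)) => //.
    exact: threshold_util_MON.
  rewrite sender_utilE// -/(util _).
  apply: (@le_trans _ _ ((Num.min 1 (m / tau j))%:E - (util (tau j))%:E)%E).
    by rewrite -EFinB lee_fin.
  by rewrite leeB//; exact: u_star_threshold.
(* If every grid threshold fell short, so would the average regret; but the average benchmark is at
   least [p - p ln p - 1 / N] and the average utility at most [p]. *)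
apply: contrapT => /forallNP H.
have /(_ _)/negP H' j := H j.
have : \sum_(j < N) N%:R^-1 * (Num.min 1 (m / tau j) - util (tau j)) <
       \sum_(j < N) N%:R^-1 * (- (p * ln p) - N%:R^-1).
  apply: ltr_sum; first by apply/hasP; exists ord0; rewrite ?mem_index_enum.
  by move=> j _; rewrite ltr_pM2l ?invr_gt0// ltNge; exact/negP.
rewrite sumr_const card_ord -[ltRHS]mulr_natl mulVKf ?gt_eqF//.
under eq_bigr do rewrite mulrBr.
rewrite sumrB -[X in _ - X]mulr_sumr.
have h1 := grid_sum_min_ge p N _ N0.
have {}h1 := h1 ltac:(by rewrite p0 p1).
have -> : \sum_(j < N) N%:R^-1 * Num.min 1 (m / tau j) =
          \sum_(j < N) N%:R^-1 * Num.min 1 (p * N%:R / j.+1%:R).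
  apply: eq_bigr => j _; congr (_ * Num.min _ _); rewrite /tau /T.
  by field; rewrite !gt_eqF.
have h2 := sum_util_threshold T N T0 N0.
have h3 : N%:R^-1 * \sum_(j < N) util (tau j) <= p.
  rewrite mulrC ler_pdivrMr//; apply: le_trans h2 _.
  by rewrite le_eqVlt; apply/orP; left; apply/eqP; rewrite /T; field; rewrite !gt_eqF.
by move: h1 h3; lra.
Qed.

End scheme.
End lower_bound.

(** * Upper bound: random quantile pooling *)

Section upper_bound.
Context {R : realType} {n : nat} (mu : 'I_n.+1 -> R).
Hypothesis mu_pos : forall i, 0 < mu i.
Hypothesis mu_sum : \sum_(i < n.+1) mu i = 1.
Let m := mu ord_max.

(* Signals [j < N] pool the top mass [p + (j+1)w]; the remaining probability of
   each state [i] goes to a fully revealing signal [N + i]. *)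
Lemma pooling_scheme (p : R) (N : nat) : 0 < p <= 1 -> 0 <= 1 + ln p -> (0 < N)%N ->
  let w := (1 - p) / N%:R in
  exists g : 'I_n.+1 -> nat -> R, [/\ forall i j, 0 <= g i j,
    forall i, \sum_(j < N + n.+1) g i j = 1 &
    forall (u : 'I_n.+1 -> bool -> R) (a : 'I_n.+1 -> R),
      MON u -> (forall i, 0 <= a i <= 1) ->
      0 <= \sum_(i < n.+1) mu i * a i * u i true ->
      0 <= u ord_max true ->
      \sum_(j < N | p + j.+1%:R * w <= \sum_(i < n.+1) mu i * a i) w
        + m * (1 + ln p) <=
      \sum_(j < N + n.+1 | 0 <= \sum_(i < n.+1) mu i * g i j * u i true)
        \sum_(i < n.+1) mu i * g i j].
Proof.
move=> /andP[p0 p1] lnp N0 w.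
have NR0 : 0 < N%:R :> R by rewrite ltr0n.
have w0 : 0 <= w by rewrite divr_ge0 ?subr_ge0// ltW.
pose y (j : nat) := p + j.+1%:R * w.
have y0 j : 0 < y j by rewrite /y ltr_wpDr// mulr_ge0.
have yN : p + N%:R * w = 1 by rewrite /w mulrC divfK ?gt_eqF// subrKC.
have y1 (j : 'I_N) : y j <= 1.
  by rewrite -yN lerD2l ler_wpM2r// ler_nat.
have cex (j : 'I_N) : exists c : 'I_n.+1 -> R, [/\ forall i, 0 <= c i <= mu i,
    \sum_(i < n.+1) c i = y j &
    forall (b v : 'I_n.+1 -> R), (forall i, 0 <= b i <= mu i) ->
      \sum_(i < n.+1) b i = y j -> {homo v : i j / (i <= j)%N >-> i <= j} ->
      \sum_(i < n.+1) b i * v i <= \sum_(i < n.+1) c i * v i].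
  by apply: top_mass => //; rewrite y1 ltW.
have /choice[c cP] := cex.
(* Signal [j] has total probability [w] and posterior [c j i / y j]; dividing by [mu i] conditions
   on the state. *)
pose q (i : 'I_n.+1) (j : 'I_N) := w * c j i / (mu i * y j).
have q0 i j : 0 <= q i j.
  have [/(_ i)/andP[c0 _] _ _] := cP j.
  by apply: divr_ge0; apply: mulr_ge0 => //; exact: ltW.
(* As [c j i <= mu i], each state spends at most the Riemann sum of [1 / y], leaving at least
   [1 + ln p] for revelation. *)
have qs i : \sum_(j < N) q i j <= - ln p.
  have := @sum_inv_le_ln R p w N p0 w0; rewrite yN ln1 sub0r; apply: le_trans.
  apply: ler_sum => j _; have [/(_ i)/andP[c0 c1] _ _] := cP j.
  have -> : q i j = w / y j * (c j i / mu i) by rewrite /q; field; rewrite !gt_eqF.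
  rewrite -/(y j) ler_piMr//; first by rewrite divr_ge0// ltW.
  by rewrite ler_pdivrMr// mul1r.
pose left i := 1 - \sum_(j < N) q i j.
have left_ge i : 1 + ln p <= left i by rewrite /left; have := qs i; lra.
have left0 i : 0 <= left i by exact: le_trans (left_ge i).
pose g (i : 'I_n.+1) (j : nat) : R :=
  if insub j is Some j' then q i j' else ((N + i)%N == j)%:R * left i.
have gl i (j : 'I_N) : g i (lshift n.+1 j) = q i j.
  by rewrite /g /= valK.
have gr i (l : 'I_n.+1) : g i (rshift N l) = (i == l)%:R * left i.
  by rewrite /g /= insubF ?eqn_add2l// ltnNge leq_addr.
have g0 i j : 0 <= g i j.
  by rewrite /g; case: insubP => [j' _ _|_]//; rewrite mulr_ge0.
exists g; split => // [i|u a uMON a01 obed un0].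
  rewrite big_split_ord /=; under eq_bigr do rewrite gl.
  under [X in _ + X]eq_bigr do rewrite gr.
  rewrite [X in _ + X](bigD1 i)//= eqxx mul1r [X in _ + (_ + X)]big1.
    by rewrite addr0 subrKC.
  by move=> l; rewrite eq_sym => /negbTE ->; rewrite mul0r.
set x := \sum_(i < n.+1) mu i * a i.
rewrite [leRHS]big_mkcond big_split_ord /=; apply: lerD.
  rewrite big_mkcond; apply: ler_sum => j _.
  have [c01 cs cmax] := cP j.
  have mq i : mu i * q i j = w / y j * c j i.
    by rewrite /q; field; rewrite !gt_eqF.
  case: ifPn => [yx|_]; last first.
    by case: ifP => // _; apply: sumr_ge0 => i _; rewrite mulr_ge0// ltW.
  rewrite (eq_bigr (fun i => w / y j * (c j i * u i true))); last first.
    by move=> i _; rewrite gl mq mulrA.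
  rewrite -mulr_sumr mulr_ge0; last 2 first.
  - by rewrite divr_ge0// ltW.
  - by apply: (top_mass_obedient mu mu_pos (y j) u a) => //; rewrite y0.
  rewrite (eq_bigr (fun i => w / y j * c j i)); last by move=> i _; rewrite gl mq.
  by rewrite -mulr_sumr cs divfK// gt_eqF.
rewrite (bigD1 ord_max)//= -[leLHS]addr0; apply: lerD; last first.
  apply: sumr_ge0 => j _; case: ifP => // _.
  by apply: sumr_ge0 => i _; rewrite mulr_ge0// ltW.
(* Index [N + n] is the signal revealing the top state, the only revealing signal counted. *)
have rev (F : 'I_n.+1 -> R) :
    \sum_(i < n.+1) mu i * g i (N + n)%N * F i = m * left ord_max * F ord_max.
  have gr' i : g i (N + n)%N = (i == ord_max)%:R * left i by rewrite -gr.
  rewrite (bigD1 ord_max)//= gr' eqxx mul1r -/m big1 ?addr0// => i /negbTE ine.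
  by rewrite gr' ine mul0r mulr0 mul0r.
have m0 : 0 < m by exact: mu_pos.
rewrite rev mulr_ge0 ?mulr_ge0 ?(ltW m0)//.
have -> : \sum_(i < n.+1) mu i * g i (N + n)%N = m * left ord_max.
  rewrite -[RHS]mulr1 -(rev (fun=> 1)).
  by apply: eq_bigr => i _; rewrite mulr1.
by rewrite ler_pM2l.
Qed.

(** The last hypothesis covers both regimes, [p = m] and [ln p = -1]. Adoption has probability at
    least [(x - w - p) + p * (1 + ln p)], so the regret exceeds [- p ln p] by at most [w]. *)
Lemma Reg_MON_le (p : R) : m <= p <= 1 -> 0 <= 1 + ln p ->
  m * (1 + ln p) = p * (1 + ln p) ->
  (Reg_MON mu <= (- (p * ln p))%:E)%E.
Proof.
move=> /andP[mp p1] lnp mpE; have m0 : 0 < m by exact: mu_pos.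
have p0 : 0 < p by exact: lt_le_trans mp.
apply/lee_addgt0Pr => e e0.
pose N := (Num.truncn e^-1).+1.
have N0 : (0 < N)%N by [].
have NR0 : 0 < N%:R :> R by rewrite ltr0n.
have Ne : N%:R^-1 <= e by rewrite invf_ple ?posrE// ltW// truncnS_gt.
have p01 : 0 < p <= 1 by rewrite p0.
have [g [g0 g1 gP]] := pooling_scheme p N p01 lnp N0.
set w := (1 - p) / N%:R in gP.
have w0 : 0 <= w by rewrite divr_ge0 ?subr_ge0// ltW.
have we : w <= e.
  by apply: le_trans Ne; rewrite ler_piMl ?invr_ge0 ?(ltW NR0)//; lra.
have pln : p * ln p <= 0 by rewrite mulr_ge0_le0 ?ln_le0// ltW.
apply: (@le_trans _ _ (regret_MON mu (counting_below (N + n.+1)) g)).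
  apply: ereal_inf_lbound; exists _, _, (counting_below (N + n.+1)), g.
  by split => //; exact: finite_scheme.
apply: ge_ereal_sup => _ [u uMON <-].
rewrite sender_util_finite//; set v := \sum_(j < _ | _) _.
rewrite leeBlDr// -!EFinD; apply: u_star_le => // a a01 obed.
set x := \sum_(i < n.+1) mu i * a i.
have x1 : x <= 1.
  rewrite -mu_sum; apply: ler_sum => i _; have /andP[_ a1] := a01 i.
  by rewrite ler_piMr// ltW.
have v0 : 0 <= v.
  by apply: sumr_ge0 => j _; apply: sumr_ge0 => i _; rewrite mulr_ge0// ltW.
(* If even the top state is rejected, monotonicity makes all utilities negative and obedience forces
   [x = 0]. *)
have [un0|un0] := leP 0 (u ord_max true); last first.
  suff -> : x = 0 by lra.
  have uneg i : u i true < 0.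
    by apply: le_lt_trans un0; apply: uMON.2; rewrite -ltnS.
  have ma0 i : 0 <= mu i * a i.
    by have /andP[? _] := a01 i; rewrite mulr_ge0// ltW.
  have : \sum_(i < n.+1) mu i * a i * u i true = 0.
    apply/le_anti; rewrite obed andbT; apply: sumr_le0 => i _.
    by rewrite mulr_ge0_le0// ltW.
  move=> /eqP; rewrite -oppr_eq0 -sumrN psumr_eq0 => [/allP au0|i _]; last first.
    by rewrite oppr_ge0 mulr_ge0_le0// ltW.
  apply: big1 => i _; have := au0 i (mem_index_enum i).
  by rewrite /= oppr_eq0 mulf_eq0 (lt_eqF (uneg i)) orbF => /eqP.
have := gP u a uMON a01 obed un0; rewrite -/v -/x mpE.
have := grid_count_ge p w x N w0.
have -> : p + N%:R * w = 1 by rewrite /w mulrC divfK ?gt_eqF// subrKC.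
have -> : Num.min (x - w) 1 = x - w by apply/min_idPl; lra.
set S := \sum_(j < N | _) w; lra.
Qed.

End upper_bound.

(** * Matching the two bounds *)

Theorem theorem2 (R : realType) (n : nat) (mu : 'I_n.+1 -> R)
  (mu_pos : forall i, 0 < mu i) (mu_sum : \sum_(i < n.+1) mu i = 1) :
  Reg_MON mu =
  (if mu ord_max <= (expR 1)^-1 then (expR 1)^-1
   else - (mu ord_max * ln (mu ord_max)))%:E.
Proof.
pose p := if mu ord_max <= (expR 1)^-1 then (expR 1)^-1 else mu ord_max.
have lne : ln (expR 1)^-1 = -1 :> R by rewrite lnV ?posrE ?expR_gt0// expRK.
have -> : (if mu ord_max <= (expR 1)^-1 then (expR 1)^-1
   else - (mu ord_max * ln (mu ord_max))) = - (p * ln p).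
  by rewrite /p; case: ifP => _//; rewrite lne mulrN1 opprK.
have mp : mu ord_max <= p <= 1.
  rewrite /p; case: ifP => [->|_]; last by rewrite lexx (top_prior_le1 mu mu_pos mu_sum).
  by rewrite invf_le1 ?expR_gt0// ltW// expR_gt1.
apply/le_anti/andP; split.
  (* Either [ln p = -1] and both products vanish, or [p] is the top prior and exceeds [1 / e], so
     [1 + ln p >= 0]. *)
  apply: Reg_MON_le => //; rewrite /p; case: ifPn; rewrite ?lne ?subrr ?mulr0//.
  rewrite -ltNge => lt.
  have : ln (expR 1)^-1 <= ln (mu ord_max).
    by rewrite ler_ln ?posrE ?invr_gt0 ?expR_gt0// ltW.
  by rewrite lne; lra.
apply: le_ereal_inf_tmp => _ [d [S [nu [f [fP ->]]]]].
exact: regret_MON_ge.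
Qed.
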